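(* Among the $240$ norm-one elements of the Coxeter--Dickson lattice $\mathbb{O}_{E_8}$, the three products (octonionic $\cdot$, para-octonionic $\bullet$, Okubo $*$) have respectively exactly $1$, $57$ and $12$ nonzero integral idempotents. That is, $$\#\{x\in\mathbb{O}_{E_8}\setminus\{0\}: x\cdot x=x\}=1,\qquad \#\{x\in\mathbb{O}_{E_8}\setminus\{0\}: x\bullet x=x\}=57,\qquad \#\{x\in\mathbb{O}_{E_8}\setminus\{0\}: x*x=x\}=12,$$ and all of these idempotents have composition norm $n(x)=1$.
   Context: Octonions. $\mathbb{O}$ is the real division algebra of octonions with unit $1$ and basis $1,\mathrm{i},\mathrm{j},\mathrm{k},\mathrm{l},\mathrm{il},\mathrm{jl},\mathrm{kl}$; each imaginary basis unit squares to $-1$, distinct imaginary basis units anticommute, and the remaining products are given by the oriented triples $(\mathrm{i},\mathrm{j},\mathrm{k})$, $(\mathrm{i},\mathrm{l},\mathrm{il})$, $(\mathrm{j},\mathrm{l},\mathrm{jl})$, $(\mathrm{k},\mathrm{l},\mathrm{kl})$, $(\mathrm{jl},\mathrm{i},\mathrm{kl})$, $(\mathrm{kl},\mathrm{j},\mathrm{il})$, $(\mathrm{il},\mathrm{k},\mathrm{jl})$, where $(x,y,z)$ means $xy=z$, $yz=x$, $zx=y$. $\bar x$ is octonionic conjugation and $n(x)=x\bar x$ is the composition norm. Lattice. $\mathbb{O}_{E_8}$ is the $\mathbb{Z}$-span of $1,\mathrm{i},\mathrm{j},\mathrm{k},\mathrm{h},\mathrm{i}\mathrm{h},\mathrm{j}\mathrm{h},\mathrm{k}\mathrm{h}$,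 where $\mathrm{h}=\tfrac12(\mathrm{i}+\mathrm{j}+\mathrm{k}+\mathrm{l})$ (the Coxeter--Dickson octonions). It is closed under conjugation and octonionic multiplication and has $240$ elements of norm $n=1$. Products. Para-octonionic product: $x\bullet y=\bar x\cdot\bar y$. Okubo product: $x*y=\tau(\bar x)\cdot\tau^2(\bar y)$, where, writing $(e_1,\dots,e_7)=(\mathrm{i},\mathrm{j},\mathrm{l},\mathrm{k},\mathrm{kl},\mathrm{jl},\mathrm{il})$, $\tau$ is the $\mathbb{R}$-linear map with $\tau(1)=1$, $\tau(e_3)=e_3$, $\tau(e_1)=e_2$, $\tau(e_2)=-e_4$, $\tau(e_4)=-e_1$, $\tau(e_5)=-e_7$, $\tau(e_7)=e_6$, $\tau(e_6)=-e_5$. The map $\tau$ is an octonion automorphism of order three preserving $\mathbb{O}_{E_8}$, so $\mathbb{O}_{E_8}$ is closed under all three products. *)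

(* Defs.v *)
From mathcomp Require Export all_boot all_order all_algebra.
From mathcomp Require Export boolp classical_sets functions cardinality reals.

Set Implicit Arguments.
Unset Strict Implicit.
Unset Printing Implicit Defensive.

Import GRing.Theory.

Local Open Scope ring_scope.

(* Octonions are given by their coordinates in the ordered basis
   1, i, j, k, l, il, jl, kl, numbered 0, ..., 7. *)
Notation octonion R := 'rV[R]_8.

Definition oct_basis (R : realType) (a : nat) : octonion R :=
  delta_mx 0 (inord a).

Definition oct_one (R : realType) : octonion R := oct_basis R 0.
Definition oct_i (R : realType) : octonion R := oct_basis R 1.
Definition oct_j (R : realType) : octonion R := oct_basis R 2.
Definition oct_k (R : realType) : octonion R := oct_basis R 3.
Definition oct_l (R : realType) : octonion R := oct_basis R 4.
Definition oct_il (R : realType) : octonion R := oct_basis R 5.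
Definition oct_jl (R : realType) : octonion R := oct_basis R 6.
Definition oct_kl (R : realType) : octonion R := oct_basis R 7.

(* (i,j,k), (i,l,il), (j,l,jl), (k,l,kl), (jl,i,kl), (kl,j,il), (il,k,jl) *)
Definition oct_triples : seq (nat * nat * nat) :=
  [:: (1, 2, 3); (1, 4, 5); (2, 4, 6); (3, 4, 7);
      (6, 1, 7); (7, 2, 5); (5, 3, 6)]%N.

(* A triple (x, y, z) stands for xy = z, yz = x and zx = y. *)
Definition oct_rules : seq (nat * nat * nat) :=
  flatten [seq [:: (t.1.1, t.1.2, t.2); (t.1.2, t.2, t.1.1);
                   (t.2, t.1.1, t.1.2)] | t <- oct_triples].

(* Each ordered pair of distinct imaginary units occurs, possibly after a swap,
   in exactly one rule, so the sum below has exactly one nonzero term. *)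
Definition oct_basis_mul (R : realType) (a b : nat) : octonion R :=
  if a == 0%N then oct_basis R b
  else if b == 0%N then oct_basis R a
  else if a == b then - oct_one R
  else \sum_(t <- oct_rules)
         (if (a, b) == t.1 then oct_basis R t.2
          else if (b, a) == t.1 then - oct_basis R t.2
          else 0).

Definition oct_mul (R : realType) (x y : octonion R) : octonion R :=
  \sum_(a < 8) \sum_(b < 8) (x 0 a * y 0 b) *: oct_basis_mul R a b.

Definition oct_conj (R : realType) (x : octonion R) : octonion R :=
  \row_a (if a == 0 then x 0 a else - x 0 a).

(* The norm takes its values in the real line spanned by the unit, so that
   "n(x) = 1" reads [oct_norm x = oct_one R]. *)
Definition oct_norm (R : realType) (x : octonion R) : octonion R :=
  oct_mul x (oct_conj x).

(* Images of 1, i, j, k, l, il, jl, kl, in this order. With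
   (e1, ..., e7) = (i, j, l, k, kl, jl, il), the relations e1 -> e2 -> - e4,
   e4 -> - e1, e3 -> e3, e5 -> - e7, e7 -> e6, e6 -> - e5 become
   i -> j -> - k, k -> - i, l -> l, kl -> - il, il -> jl, jl -> - kl. *)
Definition oct_tau_basis (R : realType) : seq (octonion R) :=
  [:: oct_one R; oct_j R; - oct_k R; - oct_i R;
      oct_l R; oct_jl R; - oct_kl R; - oct_il R].

Definition oct_tau (R : realType) (x : octonion R) : octonion R :=
  \sum_(a < 8) x 0 a *: (oct_tau_basis R)`_a.

Definition para_mul (R : realType) (x y : octonion R) : octonion R :=
  oct_mul (oct_conj x) (oct_conj y).

Definition okubo_mul (R : realType) (x y : octonion R) : octonion R :=
  oct_mul (oct_tau (oct_conj x)) (oct_tau (oct_tau (oct_conj y))).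

Definition oct_h (R : realType) : octonion R :=
  2^-1 *: (oct_i R + oct_j R + oct_k R + oct_l R).

Definition coxeter_dickson_basis (R : realType) : 8.-tuple (octonion R) :=
  [tuple oct_one R; oct_i R; oct_j R; oct_k R; oct_h R;
         oct_mul (oct_i R) (oct_h R); oct_mul (oct_j R) (oct_h R);
         oct_mul (oct_k R) (oct_h R)].

Definition coxeter_dickson (R : realType) : set (octonion R) :=
  [set x | inIntSpan (coxeter_dickson_basis R) x].

(* Main.v *)
From mathcomp Require Import ring zify.
Require Import Defs.

Set Implicit Arguments.
Unset Strict Implicit.
Unset Printing Implicit Defensive.

Import Order.TTheory GRing.Theory Num.Theory.

Local Open Scope classical_set_scope.
Local Open Scope card_scope.
Local Open Scope ring_scope.

(** Membership in the lattice is a parity condition on doubled coordinates.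
    Write x = u / 2. On l, il, jl, kl the vectors h, ih, jh, kh respectively
    have coordinate 1/2 and the other basis vectors of the lattice have
    coordinate 0, so the coefficients of x on h, ih, jh, kh must be
    u_4, ..., u_7. Solving for the remaining four shows that x lies in the
    lattice iff u is integral and satisfies four parity checks, those of the
    extended Hamming code of length 8: this is E8 by Construction A
    ([coxeter_dicksonP]). The norm of x is a quarter of the sum of the u_a ^ 2.

    The eight-square identity ([sum_sq_mul]) says that the norm is
    multiplicative. Conjugation and tau preserve it, so an idempotent of any
    of the three products has n(x) = n(x) ^ 2, and a nonzero one has norm 1
    ([sum_sq_idempotent]). Hence all the sets to be counted lie among the
    lattice vectors for which the u_a ^ 2 sum to 4. These finitely many u are
    listed by a recursion on the length. In doubled coordinates being idempotent
    is an equation between integer vectors ([oct_mul_halfP]), so the cardinals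
    are found by evaluating this equation on the whole list
    ([card_half_vec]). *)

(** * Coordinates of the octonion product *)

Lemma oct_basisE (R : realType) (a : nat) (c : 'I_8) :
  (a < 8)%N -> oct_basis R a 0 c = (c == a :> nat)%:R.
Proof. by move=> lt_a; rewrite mxE eqxx -val_eqE /= inordK. Qed.

(** The multiplication table in explicit form, over any commutative ring: it is
    used over [R] to compute [oct_mul] and over [int] for the counts. *)
Definition mul_coords (T : comNzRingType) (x y : seq T) : seq T :=
  [:: x`_0 * y`_0 - x`_1 * y`_1 - x`_2 * y`_2 - x`_3 * y`_3
      - x`_4 * y`_4 - x`_5 * y`_5 - x`_6 * y`_6 - x`_7 * y`_7;
      x`_0 * y`_1 + x`_1 * y`_0 + x`_2 * y`_3 - x`_3 * y`_2
      + x`_4 * y`_5 - x`_5 * y`_4 - x`_6 * y`_7 + x`_7 * y`_6;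
      x`_0 * y`_2 - x`_1 * y`_3 + x`_2 * y`_0 + x`_3 * y`_1
      + x`_4 * y`_6 + x`_5 * y`_7 - x`_6 * y`_4 - x`_7 * y`_5;
      x`_0 * y`_3 + x`_1 * y`_2 - x`_2 * y`_1 + x`_3 * y`_0
      + x`_4 * y`_7 - x`_5 * y`_6 + x`_6 * y`_5 - x`_7 * y`_4;
      x`_0 * y`_4 - x`_1 * y`_5 - x`_2 * y`_6 - x`_3 * y`_7
      + x`_4 * y`_0 + x`_5 * y`_1 + x`_6 * y`_2 + x`_7 * y`_3;
      x`_0 * y`_5 + x`_1 * y`_4 - x`_2 * y`_7 + x`_3 * y`_6
      - x`_4 * y`_1 + x`_5 * y`_0 - x`_6 * y`_3 + x`_7 * y`_2;
      x`_0 * y`_6 + x`_1 * y`_7 + x`_2 * y`_4 - x`_3 * y`_5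
      - x`_4 * y`_2 + x`_5 * y`_3 + x`_6 * y`_0 - x`_7 * y`_1;
      x`_0 * y`_7 - x`_1 * y`_6 + x`_2 * y`_5 + x`_3 * y`_4
      - x`_4 * y`_3 - x`_5 * y`_2 + x`_6 * y`_1 + x`_7 * y`_0].

(** Integer structure constants: the e_c coordinate of e_a e_b, in a form that
    evaluates on concrete indices. *)
Definition basis_mul_coord (a b c : nat) : int :=
  if a == 0%N then (c == b)%:Z
  else if b == 0%N then (c == a)%:Z
  else if a == b then - (c == 0%N)%:Z
  else foldr (fun t s => (if (a, b) == t.1 then (c == t.2)%:Z
                          else if (b, a) == t.1 then - (c == t.2)%:Z
                          else 0) + s) 0 oct_rules.

Lemma oct_basis_mulE (R : realType) (a b : nat) (c : 'I_8) :
  (a < 8)%N -> (b < 8)%N ->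
  oct_basis_mul R a b 0 c = (basis_mul_coord a b c)%:~R.
Proof.
move=> lt_a lt_b; rewrite /oct_basis_mul /basis_mul_coord.
case: ifP => _; first by rewrite oct_basisE.
case: ifP => _; first by rewrite oct_basisE.
case: ifP => _; first by rewrite mxE oct_basisE // rmorphN.
rewrite summxE; have : all (fun t => t.2 < 8)%N oct_rules by [].
elim: oct_rules => [|t s IHs] /=; first by rewrite big_nil.
case/andP=> lt_t /IHs{}IHs; rewrite big_cons IHs rmorphD /=; congr (_ + _).
case: ifP => _; first by rewrite oct_basisE.
by case: ifP => _; rewrite mxE ?oct_basisE // rmorphN.
Qed.

Lemma sum_ord8 (V : nmodType) (F : nat -> V) :
  \sum_(a < 8) F a = F 0 + F 1 + F 2 + F 3 + F 4 + F 5 + F 6 + F 7.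
Proof. by rewrite !big_ord_recr big_ord0 /= add0r. Qed.

Lemma oct_mulE (R : realType) (x y : octonion R) :
  oct_mul x y = \row_(c < 8)
    (mul_coords [seq x 0 (inord a) | a <- iota 0 8]
                [seq y 0 (inord a) | a <- iota 0 8])`_c.
Proof.
apply/rowP => c; rewrite summxE mxE.
pose F (a b : nat) : R :=
  x 0 (inord a) * y 0 (inord b) * (basis_mul_coord a b c)%:~R.
transitivity (\sum_(a < 8) \sum_(b < 8) F a b).
  apply: eq_bigr => a _; rewrite summxE; apply: eq_bigr => b _.
  by rewrite /F mxE !inord_val oct_basis_mulE.
rewrite (sum_ord8 (fun a => \sum_(b < 8) F a b)) !(sum_ord8 (F _)) /F {F}.
case: c => [] [|[|[|[|[|[|[|[|//]]]]]]]] _ /=.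
(* Evaluating the 64 structure constants first leaves [ring] a bilinear
   identity with coefficients 0, 1, -1. *)
all: repeat match goal with |- context [basis_mul_coord ?a ?b ?c] =>
  let v := eval vm_compute in (basis_mul_coord a b c) in
  change (basis_mul_coord a b c) with v end.
all: ring.
Qed.

(** * Half-integral octonions *)

Definition half_vec (R : realType) (u : seq int) : octonion R :=
  \row_(a < 8) ((u`_a)%:~R / 2).

Definition twice (u : seq int) : seq int := [seq 2 * z | z <- u].

Lemma half_vecE (R : realType) (u : seq int) (c : 'I_8) :
  half_vec R u 0 c = (u`_c)%:~R / 2.
Proof. by rewrite mxE. Qed.

Lemma half_vec_inj (R : realType) (u v : seq int) :
  size u = 8%N -> size v = 8%N -> half_vec R u = half_vec R v -> u = v.
Proof.
move=> size_u size_v /rowP eq_uv.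
apply: (@eq_from_nth _ 0) => [|c]; first by rewrite size_u size_v.
rewrite size_u => lt_c; have := eq_uv (Ordinal lt_c).
have half_neq0 : (2 : R)^-1 != 0 by rewrite invr_eq0 pnatr_eq0.
by rewrite !half_vecE => /(mulIf half_neq0)/intr_inj.
Qed.

Lemma half_vec_twice (R : realType) (u : seq int) :
  half_vec R (twice u) = 2 *: half_vec R u.
Proof.
apply/rowP => c; rewrite [RHS]mxE !half_vecE /twice.
have [lt_c|le_c] := ltnP c (size u); first by rewrite (nth_map 0) //; field.
by rewrite !nth_default ?size_map // mul0r mulr0.
Qed.

Lemma oct_mul_half (R : realType) (u v : seq int) :
  oct_mul (half_vec R u) (half_vec R v) = 2^-1 *: half_vec R (mul_coords u v).
Proof.
apply/rowP => c; rewrite oct_mulE [RHS]mxE half_vecE mxE.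
rewrite /= !half_vecE !inordK //.
by case: c => [] [|[|[|[|[|[|[|[|//]]]]]]]] _ /=; field.
Qed.

(** The product of two halves is a quarter of an integer vector, so comparing it
    with the half of w leaves a factor 2. *)
Lemma oct_mul_halfP (R : realType) (u v w : seq int) : size w = 8%N ->
  oct_mul (half_vec R u) (half_vec R v) = half_vec R w <->
  mul_coords u v = twice w.
Proof.
move=> size_w; rewrite oct_mul_half; split=> [eq_w|->].
  apply: (@half_vec_inj R); rewrite ?size_map ?half_vec_twice //.
  by rewrite -eq_w scalerA divff ?scale1r // pnatr_eq0.
by rewrite half_vec_twice scalerA mulVf ?scale1r // pnatr_eq0.
Qed.

Definition conj_coords (u : seq int) : seq int :=
  [:: u`_0; - u`_1; - u`_2; - u`_3; - u`_4; - u`_5; - u`_6; - u`_7].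

Lemma oct_conj_half (R : realType) (u : seq int) :
  oct_conj (half_vec R u) = half_vec R (conj_coords u).
Proof.
apply/rowP => c; rewrite mxE half_vecE.
by case: c => [] [|[|[|[|[|[|[|[|//]]]]]]]] lt_c;
   rewrite -val_eqE half_vecE /= ?rmorphN ?mulNr.
Qed.

Definition tau_coords (u : seq int) : seq int :=
  [:: u`_0; - u`_3; u`_1; - u`_2; u`_4; - u`_7; u`_5; - u`_6].

Lemma oct_tau_half (R : realType) (u : seq int) :
  oct_tau (half_vec R u) = half_vec R (tau_coords u).
Proof.
pose F a := half_vec R u 0 (inord a) *: (oct_tau_basis R)`_a.
transitivity (\sum_(a < 8) F a).
  by apply: eq_bigr => a _; rewrite /F inord_val.
rewrite sum_ord8 {}/F /=; apply/rowP => c; rewrite [RHS]half_vecE.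
rewrite !mxE !inordK //.
by case: c => [] [|[|[|[|[|[|[|[|//]]]]]]]] lt_c;
   rewrite !eqxx -!val_eqE /= !inordK //=; field.
Qed.

Lemma oct_one_half (R : realType) :
  oct_one R = half_vec R [:: 2; 0; 0; 0; 0; 0; 0; 0].
Proof.
apply/rowP => c; rewrite oct_basisE // half_vecE.
by case: c => [] [|[|[|[|[|[|[|[|//]]]]]]]] lt_c /=; field.
Qed.

(** * The norm and the eight-square identity *)

(** Four times the norm of u / 2. It is a [nat], so that it can bound the
    entries in the recursive enumeration of the vectors with a given value. *)
Definition sum_sq (u : seq int) : nat := sumn [seq (`|z| ^ 2)%N | z <- u].

(** Positive definiteness of the norm. *)
Lemma half_vec_eq0 (R : realType) (u : seq int) : size u = 8%N ->
  half_vec R u = 0 <-> sum_sq u = 0%N.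
Proof.
move=> size_u; split=> [u0|sum_u].
  have half0 : half_vec R (nseq 8 0) = 0.
    by apply/rowP => c; rewrite half_vecE mxE nth_nseq if_same mul0r.
  by rewrite (half_vec_inj size_u _ (etrans u0 (esym half0))).
apply/rowP => c; rewrite half_vecE mxE.
suff -> : u`_c = 0 by rewrite mul0r.
elim: u {size_u} sum_u (c : nat) => [|z u IHu];
  first by move=> _ k; rewrite nth_nil.
rewrite /sum_sq /= => sum_zu [|k] /=; first by lia.
by apply: IHu; rewrite /sum_sq; lia.
Qed.

Lemma sum_sqE (u : seq int) :
  (sum_sq u)%:Z = foldr (fun z s => z ^+ 2 + s) 0 u.
Proof.
by elim: u => //= z u <-; rewrite PoszD; congr (_ + _); lia.
Qed.

(** Degen's eight-square identity, i.e. multiplicativity of the octonion norm,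
    as a polynomial identity in the sixteen coordinates. *)
Lemma sum_sq_mul (u v : seq int) : size u = 8%N -> size v = 8%N ->
  sum_sq (mul_coords u v) = (sum_sq u * sum_sq v)%N.
Proof.
case: u => [|u0[|u1[|u2[|u3[|u4[|u5[|u6[|u7[|]]]]]]]]] // _.
case: v => [|v0[|v1[|v2[|v3[|v4[|v5[|v6[|v7[|]]]]]]]]] // _.
by apply: (can_inj absz_nat); rewrite PoszM !sum_sqE /=; ring.
Qed.

Lemma mul_conj_coords (u : seq int) : size u = 8%N ->
  mul_coords u (conj_coords u) = [:: (sum_sq u)%:Z; 0; 0; 0; 0; 0; 0; 0].
Proof.
case: u => [|u0[|u1[|u2[|u3[|u4[|u5[|u6[|u7[|]]]]]]]]] // _.
by rewrite sum_sqE /mul_coords /=; do !congr (_ :: _); ring.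
Qed.

Lemma oct_norm_half (R : realType) (u : seq int) : size u = 8%N ->
  oct_norm (half_vec R u) = oct_one R <-> sum_sq u = 4.
Proof.
move=> size_u; rewrite /oct_norm oct_conj_half oct_one_half oct_mul_halfP //.
by rewrite mul_conj_coords //; split=> [[]|->].
Qed.

Definition isometry8 (f : seq int -> seq int) :=
  forall u, size u = 8%N -> size (f u) = 8%N /\ sum_sq (f u) = sum_sq u.

Lemma isometry8_conj : isometry8 conj_coords.
Proof.
case=> [|u0[|u1[|u2[|u3[|u4[|u5[|u6[|u7[|]]]]]]]]] // _; split=> //.
by apply: (can_inj absz_nat); rewrite !sum_sqE /=; ring.
Qed.

Lemma isometry8_tau : isometry8 tau_coords.
Proof.
case=> [|u0[|u1[|u2[|u3[|u4[|u5[|u6[|u7[|]]]]]]]]] // _; split=> //.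
by apply: (can_inj absz_nat); rewrite !sum_sqE /=; ring.
Qed.

Lemma isometry8_comp f g : isometry8 f -> isometry8 g -> isometry8 (f \o g).
Proof. by move=> isom_f isom_g u /isom_g[size_gu <-]; apply: isom_f. Qed.

(** For u / 2 idempotent, taking sums of squares in f(u) g(u) = 2 u gives
    N ^ 2 = 4 N, where N = sum_sq u. *)
Lemma sum_sq_idempotent f g u : isometry8 f -> isometry8 g ->
  size u = 8%N -> sum_sq u <> 0%N ->
  mul_coords (f u) (g u) = twice u -> sum_sq u = 4.
Proof.
move=> isom_f isom_g size_u nz_u eq_u.
have [[size_f sum_f] [size_g sum_g]] := (isom_f _ size_u, isom_g _ size_u).
have := sum_sq_mul size_f size_g; rewrite eq_u sum_f sum_g.
have -> : sum_sq (twice u) = (4 * sum_sq u)%N.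
  elim: u {size_u nz_u eq_u size_f sum_f size_g sum_g} => //= z u IHu.
  by rewrite /sum_sq /= in IHu *; rewrite IHu abszM; lia.
nia.
Qed.

(** * The lattice as Construction A *)

(** The four parity checks of the extended Hamming code of length 8. *)
Definition hamming (u : seq int) : bool :=
  [&& (2 %| u`_0 + u`_5 + u`_6 + u`_7)%Z, (2 %| u`_1 + u`_4 + u`_6 + u`_7)%Z,
      (2 %| u`_2 + u`_4 + u`_5 + u`_7)%Z & (2 %| u`_3 + u`_4 + u`_5 + u`_6)%Z].

Lemma coxeter_dicksonP (R : realType) (x : octonion R) :
  coxeter_dickson x <->
  exists2 u, size u = 8%N /\ hamming u & x = half_vec R u.
Proof.
(* The doubled coordinates of the combination with coefficients b. *)
pose span (b : nat -> int) : seq int :=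
  [:: 2 * b 0 - b 5 - b 6 - b 7; 2 * b 1 + b 4 + b 6 - b 7;
      2 * b 2 + b 4 - b 5 + b 7; 2 * b 3 + b 4 + b 5 - b 6;
      b 4; b 5; b 6; b 7].
have spanE (b : nat -> int) : \sum_(m < 8) (coxeter_dickson_basis R)`_m *~ b m =
    half_vec R (span b).
  pose F m : octonion R := (b m)%:~R *: (coxeter_dickson_basis R)`_m.
  transitivity (\sum_(m < 8) F m).
    by apply: eq_bigr => m _; rewrite /F scaler_int.
  rewrite sum_ord8 {}/F /= oct_one_half.
  have unit_half k : (k < 8)%N -> oct_basis R k = half_vec R (ncons k 0 [:: 2]).
    move=> lt_k; apply/rowP => c; rewrite oct_basisE // half_vecE nth_ncons.
    case: ltngtP => [_|gt_c|->]; first by rewrite mul0r.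
      by rewrite nth_default ?mul0r // subn_gt0.
    by rewrite subnn divff // pnatr_eq0.
  have h_half : oct_h R = half_vec R [:: 0; 1; 1; 1; 1].
    rewrite /oct_h /oct_i /oct_j /oct_k /oct_l !unit_half //.
    apply/rowP => c; rewrite !mxE.
    by case: c => [] [|[|[|[|[|[|[|[|//]]]]]]]] lt_c /=; field.
  have ih_half : oct_mul (oct_i R) (oct_h R) =
      half_vec R [:: -1; 0; -1; 1; 0; 1; 0; 0].
    by rewrite h_half /oct_i unit_half //; apply/oct_mul_halfP.
  have jh_half : oct_mul (oct_j R) (oct_h R) =
      half_vec R [:: -1; 1; 0; -1; 0; 0; 1; 0].
    by rewrite h_half /oct_j unit_half //; apply/oct_mul_halfP.
  have kh_half : oct_mul (oct_k R) (oct_h R) =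
      half_vec R [:: -1; -1; 1; 0; 0; 0; 0; 1].
    by rewrite h_half /oct_k unit_half //; apply/oct_mul_halfP.
  rewrite ih_half jh_half kh_half h_half /oct_i /oct_j /oct_k !unit_half //.
  apply/rowP => c; rewrite !mxE.
  by case: c => [] [|[|[|[|[|[|[|[|//]]]]]]]] lt_c /=; field.
split.
  case=> a ->; exists (span (fun m => a (inord m))).
    by rewrite /hamming; split => //=; apply/and4P; split; lia.
  by rewrite -spanE; apply: eq_bigr => m _; rewrite inord_val.
case=> u [size_u /and4P[]].
move=> /dvdzP[b0 e0] /dvdzP[b1 e1] /dvdzP[b2 e2] /dvdzP[b3 e3] ->.
(* Inverse of [span]: for instance the coefficient on i is
   (u_1 - u_4 - u_6 + u_7) / 2 = (u_1 + u_4 + u_6 + u_7) / 2 - u_4 - u_6,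
   where the parity check makes the last fraction the integer b1. *)
pose b : nat -> int := nth 0 [:: b0; b1 - u`_4 - u`_6; b2 - u`_4 - u`_7;
   b3 - u`_4 - u`_5; u`_4; u`_5; u`_6; u`_7].
exists [ffun m : 'I_8 => b m].
under eq_bigr do rewrite ffunE.
rewrite spanE; congr half_vec.
case: u size_u e0 e1 e2 e3 @b
  => [|u0[|u1[|u2[|u3[|u4[|u5[|u6[|u7[|]]]]]]]]] // _.
rewrite /span /= => e0 e1 e2 e3; do !congr (_ :: _) => //; lia.
Qed.

(** * Counting vectors of norm one *)

(** All integer vectors of length n whose squares sum to N. The first entry
    satisfies z ^ 2 <= N, hence lies between - N and N. *)
Fixpoint sphere (n N : nat) : seq (seq int) :=
  if n is n'.+1 then
    flatten [seq [seq z :: u | u <- sphere n' (N - `|z| ^ 2)%N]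
            | z <- [seq k%:Z - N%:Z | k <- iota 0 N.*2.+1] & (`|z| ^ 2 <= N)%N]
  else if N == 0%N then [:: [::]] else [::].

Lemma mem_sphere u N : sum_sq u = N -> u \in sphere (size u) N.
Proof.
elim: u N => [|z u IHu] N sum_zu; first by rewrite -sum_zu.
have {}sum_zu : (`|z| ^ 2 + sum_sq u)%N = N by [].
apply/flattenP; exists [seq z :: v | v <- sphere (size u) (N - `|z| ^ 2)%N].
  apply: (map_f (fun z => [seq z :: v | v <- sphere (size u) (N - `|z| ^ 2)%N])).
  rewrite mem_filter -{1}sum_zu leq_addr andTb.
  apply/mapP; exists (absz (z + N%:Z)); last by nia.
  by rewrite mem_iota; nia.
by apply: map_f; apply: IHu; lia.
Qed.

Lemma size_sphere n N u : u \in sphere n N -> size u = n /\ sum_sq u = N.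
Proof.
elim: n N u => [|n IHn] N u.
  by case: N => // /[!inE] /eqP->.
case/flattenP=> _ /mapP[z + ->] /mapP[v /IHn[<- sum_v] ->].
rewrite mem_filter => /andP[le_z _]; split=> //.
have -> : sum_sq (z :: v) = (`|z| ^ 2 + sum_sq v)%N by [].
by rewrite sum_v subnKC.
Qed.

Definition minimal_vectors : seq (seq int) := [seq u <- sphere 8 4 | hamming u].

(** [half_vec] is injective on vectors of length 8, so a set of norm-one lattice
    octonions is enumerated without repetition by a filtered list. *)
Lemma card_half_vec (R : realType) (p : pred (seq int))
    (A : set (octonion R)) :
  (forall x, A x <-> exists2 u,
     [/\ size u = 8%N, hamming u, sum_sq u = 4 & p u] & x = half_vec R u) ->
  A #= `I_(count p minimal_vectors).
Proof.
move=> AP; rewrite -size_filter; set s := seq.filter p minimal_vectors.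
have uniq_s : uniq s by apply: filter_uniq; vm_compute.
have size_nth8 k : (k < size s)%N -> size (nth [::] s k) = 8%N.
  by move=> /(mem_nth [::]); rewrite !mem_filter => /and3P[_ _ /size_sphere[]].
have -> : A = (fun k => half_vec R (nth [::] s k)) @` `I_(size s).
  apply/seteqP; split=> [x /AP[u [size_u ham_u sum_u pu] ->]|_ [k /= lt_k <-]].
    have s_u : u \in s.
      by rewrite !mem_filter pu ham_u -size_u mem_sphere.
    by exists (index u s); rewrite /= ?index_mem ?nth_index.
  apply/AP; exists (nth [::] s k) => //; have := mem_nth [::] lt_k.
  by rewrite !mem_filter => /and3P[-> -> /size_sphere[]].
apply: inj_card_eq => k l /set_mem /= lt_k /set_mem /= lt_l.
move=> /half_vec_inj eq_kl; apply/eqP.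
by rewrite -(nth_uniq [::] lt_k lt_l uniq_s) eq_kl ?size_nth8.
Qed.

(** * Idempotents *)

(** The map m is the square x |-> f(x) g(x) for one of the three products, which
    correspond to the pairs of isometries f = g = id, f = g = conjugation, and
    f = tau o conjugation, g = tau o tau o conjugation. *)
Lemma idempotentP (R : realType) (m : octonion R -> octonion R) f g :
  isometry8 f -> isometry8 g ->
  (forall u, m (half_vec R u) =
     oct_mul (half_vec R (f u)) (half_vec R (g u))) ->
  forall x, [/\ coxeter_dickson x, x != 0 & m x = x] <->
    exists2 u, [/\ size u = 8%N, hamming u, sum_sq u = 4 &
                   mul_coords (f u) (g u) == twice u] & x = half_vec R u.
Proof.
move=> isom_f isom_g mE x; split.
  case=> /coxeter_dicksonP[u [size_u ham_u] ->] /eqP nz_u.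
  rewrite mE oct_mul_halfP // => eq_u; exists u => //.
  split=> //; last exact/eqP.
  apply: (sum_sq_idempotent isom_f isom_g size_u _ eq_u).
  by move/(half_vec_eq0 R size_u).
case=> u [size_u ham_u sum_u /eqP eq_u] ->; split.
- by apply/coxeter_dicksonP; exists u.
- by apply/eqP => /(half_vec_eq0 R size_u); rewrite sum_u.
- by rewrite mE oct_mul_halfP.
Qed.

Theorem mainTheorem1 (R : realType) :
  ([set x : octonion R | coxeter_dickson x /\ oct_norm x = oct_one R]
     #= `I_240) /\
  ([set x : octonion R | [/\ coxeter_dickson x, x != 0 & oct_mul x x = x]]
     #= `I_1) /\
  ([set x : octonion R | [/\ coxeter_dickson x, x != 0 & para_mul x x = x]]
     #= `I_57) /\
  ([set x : octonion R | [/\ coxeter_dickson x, x != 0 & okubo_mul x x = x]]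
     #= `I_12) /\
  (forall x : octonion R, coxeter_dickson x -> x != 0 ->
     oct_mul x x = x \/ para_mul x x = x \/ okubo_mul x x = x ->
     oct_norm x = oct_one R).
Proof.
have isom_id : isometry8 id by [].
have isom_tc := isometry8_comp isometry8_tau isometry8_conj.
have isom_ttc := isometry8_comp isometry8_tau isom_tc.
have octP x := @idempotentP R (fun x => oct_mul x x) _ _ isom_id isom_id
  (fun u => erefl) x.
have paraP x := @idempotentP R (fun x => para_mul x x) _ _
  isometry8_conj isometry8_conj
  (fun u => congr2 (@oct_mul R) (oct_conj_half R u) (oct_conj_half R u)) x.
have okuboP x := @idempotentP R (fun x => okubo_mul x x) _ _ isom_tc isom_ttc
  (fun u => etrans (congr1 (fun y => oct_mul (oct_tau y) (oct_tau (oct_tau y)))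
                           (oct_conj_half R u))
    (congr2 (@oct_mul R) (oct_tau_half R _)
      (etrans (congr1 _ (oct_tau_half R _)) (oct_tau_half R _)))) x.
split; [|split; [|split; [|split]]].
- rewrite (_ : 240 = count xpredT minimal_vectors)%N; last by vm_compute.
  apply: card_half_vec => x; split.
    case=> /coxeter_dicksonP[u [size_u ham_u] ->].
    move=> /(oct_norm_half R size_u) sum_u.
    by exists u.
  case=> u [size_u ham_u sum_u _] ->; split; last exact/oct_norm_half.
  by apply/coxeter_dicksonP; exists u.
- have := card_half_vec octP.
  by rewrite (_ : count _ _ = 1%N); last by vm_compute.
- have := card_half_vec paraP.
  by rewrite (_ : count _ _ = 57%N); last by vm_compute.
- have := card_half_vec okuboP.
  by rewrite (_ : count _ _ = 12%N); last by vm_compute.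
- move=> x Lx nz_x [idx|[idx|idx]].
  + have /octP[u [size_u _ sum_u _] ->] := And3 Lx nz_x idx.
    exact/oct_norm_half.
  + have /paraP[u [size_u _ sum_u _] ->] := And3 Lx nz_x idx.
    exact/oct_norm_half.
  + have /okuboP[u [size_u _ sum_u _] ->] := And3 Lx nz_x idx.
    exact/oct_norm_half.
Qed.
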